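(* Let $c_2>0$ and $c_3\in\mathbb{R}$. For $\alpha\ge c_2$ put $J(\alpha)=\int_{c_2}^{\alpha}c_2^{2m-1}\left(\rho^{2m}-c_2^{2m}\right)^{-\frac{2m-1}{2m}}d\rho$. Then $d_1:=\lim_{\alpha\to\infty}J(\alpha)$ is a finite positive number, and $J$ is a strictly increasing bijection $[c_2,\infty)\to[0,d_1)$. Define $\hat\alpha:(c_3-d_1,c_3+d_1)\to[c_2,\infty)$ by letting $\hat\alpha(u)$ be the unique $\alpha\ge c_2$ with $J(\alpha)=|u-c_3|$ (so $\hat\alpha(c_3)=c_2$). Then $\hat\alpha$ is a $C^2$ function with $\hat\alpha'(c_3)=\hat\alpha''(c_3)=0$, $\hat\alpha(u)\to\infty$ as $u\to c_3\pm d_1$, and the rotational surface $$\hat f(u,v)=(\hat\alpha(u)\cos v,\ \hat\alpha(u)\sin v,\ u),\qquad (u,v)\in(c_3-d_1,c_3+d_1)\times[0,2\pi],$$ has a Birkhoff–Gauss map that extends as a $C^1$ map to the whole domain and is minimal, i.e. its Minkowski mean curvature vanishes identically.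
   Context: Fix an integer $m\ge 2$. Let $\Phi(x_1,x_2,x_3)=(x_1^2+x_2^2)^m+x_3^{2m}$ and let $\|\cdot\|$ be the norm on $\mathbb{R}^3$ whose unit sphere is $S=\{x\in\mathbb{R}^3:\Phi(x)=1\}$ (a smooth, strictly convex surface). For a surface given by a parametrization $f(s,v)$, its Birkhoff–Gauss map $\eta$ is the map into $S$ defined by requiring $\eta\in S$ and $\nabla\Phi(\eta)=\mu\, f_s\times f_v$ for some function $\mu>0$, where $\times$ is the standard cross product (so the tangent plane of $S$ at $\eta(p)$ is parallel to $T_pM$, and $d\eta_p$ is an endomorphism of $T_pM$). Where $\eta$ is $C^1$, the Minkowski Gaussian curvature is $K=\det(d\eta_p)$ and the Minkowski mean curvature is $H=\tfrac12\operatorname{trace}(d\eta_p)$; the surface is minimal if $H\equiv 0$. *)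

(* Defs.v *)
From HB Require Import structures.
From mathcomp Require Import all_boot all_order all_algebra.
From mathcomp Require Import all_classical all_reals all_analysis.
Set Implicit Arguments. Unset Strict Implicit. Unset Printing Implicit Defensive.
Import Order.TTheory GRing.Theory Num.Theory.
Import numFieldNormedType.Exports.
Local Open Scope classical_set_scope.
Local Open Scope ring_scope.

Section Defs.
Variable R : realType.

Definition vec3 (a b c : R) : 'rV[R]_3 := \row_(i < 3) [:: a; b; c]`_i.
Definition cx (x : 'rV[R]_3) : R := x ord0 (inord 0).
Definition cy (x : 'rV[R]_3) : R := x ord0 (inord 1).
Definition cz (x : 'rV[R]_3) : R := x ord0 (inord 2).

Definition cross (x y : 'rV[R]_3) : 'rV[R]_3 :=
  vec3 (cy x * cz y - cz x * cy y) (cz x * cx y - cx x * cz y)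
       (cx x * cy y - cy x * cx y).

Definition Phi (m : nat) (x : 'rV[R]_3) : R :=
  (cx x ^+ 2 + cy x ^+ 2) ^+ m + cz x ^+ (2 * m).

Definition gradPhi (m : nat) (x : 'rV[R]_3) : 'rV[R]_3 :=
  \row_(i < 3) derive (Phi m) x (delta_mx 0 i : 'rV[R]_3).

Definition pd_u (F : R -> R -> 'rV[R]_3) (u v : R) : 'rV[R]_3 :=
  derive1 (fun s => F s v) u.
Definition pd_v (F : R -> R -> 'rV[R]_3) (u v : R) : 'rV[R]_3 :=
  derive1 (fun t => F u t) v.

Definition is_BG_map (m : nat) (f eta : R -> R -> 'rV[R]_3)
    (D : set (R * R)) : Prop :=
  forall u v, D (u, v) ->
    Phi m (eta u v) = 1 /\
    exists mu : R, 0 < mu /\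
      gradPhi m (eta u v) = mu *: cross (pd_u f u v) (pd_v f u v).

Definition C1_on (eta : R -> R -> 'rV[R]_3) (D : set (R * R)) : Prop :=
  forall p : R * R, D p ->
    derivable (fun s => eta s p.2) p.1 1 /\
    derivable (fun t => eta p.1 t) p.2 1 /\
    {for p, continuous (fun q : R * R => pd_u eta q.1 q.2)} /\
    {for p, continuous (fun q : R * R => pd_v eta q.1 q.2)}.

(* trace of d(eta)_p as an endomorphism of T_pM, written in the basis
   (f_u, f_v) of T_pM: d eta(f_u) = eta_u = a f_u + b f_v,
   d eta(f_v) = eta_v = c f_u + d f_v, trace = a + d. *)
Definition trace_deta_is (f eta : R -> R -> 'rV[R]_3) (u v t : R) : Prop :=
  exists a b c d : R,
    pd_u eta u v = a *: pd_u f u v + b *: pd_v f u v /\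
    pd_v eta u v = c *: pd_u f u v + d *: pd_v f u v /\
    a + d = t.

(* Minkowski mean curvature H = trace/2 vanishes identically on D *)
Definition mink_minimal (f eta : R -> R -> 'rV[R]_3) (D : set (R * R)) : Prop :=
  forall u v, D (u, v) -> trace_deta_is f eta u v 0.

Definition Jintegrand (m : nat) (c2 rho : R) : R :=
  c2 ^+ (2 * m - 1) *
  (rho ^+ (2 * m) - c2 ^+ (2 * m)) `^ (- ((2 * m - 1)%:R / (2 * m)%:R)).

Definition Jext (m : nat) (c2 alpha : R) : \bar R :=
  (\int[@lebesgue_measure R]_(rho in `[c2, alpha]) (Jintegrand m c2 rho)%:E)%E.

Definition J (m : nat) (c2 alpha : R) : R := fine (Jext m c2 alpha).

Definition d1 (m : nat) (c2 : R) : R := lim (J m c2 a @[a --> +oo]).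

End Defs.

(* Main.v *)
(** Put [p = 2m - 1] and use [w = (alpha')^(1/p)] as parameter.  With
    [radius w = (1 + w^(p+1))^(1/(p+1))] one has [alpha = c2 * radius w], and the
    substitution [rho = c2 * radius s] turns [J] into
    [G w = \int_0^w c2 / (radius s)^p ds], whose integrand is smooth, even and
    integrable on the line.  So [J (c2 * radius w) = G |w|], [G] is an odd increasing
    bijection onto [(-d1, d1)], and [alpha-hat u = c2 * radius (w u)] where
    [w u = G^-1 (u - c3)] solves [w' = (radius w)^p / c2]; hence [alpha-hat' = w^p].
    The Birkhoff-Gauss map is
    [eta = (- cos v / radius w, - sin v / radius w, w / radius w)], and
    [eta_u = k f_u], [eta_v = - k f_v] with [k = 1 / (c2 * (radius w)^2)]. *)

Require Import Defs.
From HB Require Import structures.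
From mathcomp Require Import all_boot all_order all_algebra.
From mathcomp Require Import all_classical all_reals all_analysis.
From mathcomp Require Import measurable_realfun zify ring.
Import Order.TTheory GRing.Theory Num.Theory.
Import numFieldNormedType.Exports.
Local Open Scope classical_set_scope.
Local Open Scope ring_scope.

Set Implicit Arguments.
Unset Strict Implicit.
Unset Printing Implicit Defensive.

(** * Pointwise rules of differentiation *)

Lemma derivable_continuous (R : realType) (f : R -> R) (x : R) :
  derivable f x 1 -> {for x, continuous f}.
Proof. by move=> /derivable1_diffP /differentiable_continuous. Qed.

Lemma is_derive_continuous (R : realType) (f : R -> R) (x d : R) :
  is_derive x 1 f d -> {for x, continuous f}.
Proof. by case=> + _; exact: derivable_continuous. Qed.

Lemma is_derive_exprn (R : realType) (V : normedModType R) (f : V -> R)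
    (n : nat) (x v : V) (d : R) :
  is_derive x v f d -> is_derive x v (fun y => f y ^+ n) (n%:R * f x ^+ n.-1 * d).
Proof.
by move=> fd; rewrite -(exprfctE f n); exact: is_deriveX.
Qed.

Lemma is_derive_add (R : realType) (V W : normedModType R) (f g : V -> W)
    (x v : V) (d e : W) :
  is_derive x v f d -> is_derive x v g e ->
  is_derive x v (fun y => f y + g y) (d + e).
Proof. by move=> fd ge; rewrite -(addrfctE f g); exact: is_deriveD. Qed.

Lemma is_derive_mul (R : realType) (V : normedModType R) (f g : V -> R)
    (x v : V) (d e : R) :
  is_derive x v f d -> is_derive x v g e ->
  is_derive x v (fun y => f y * g y) (f x * e + g x * d).
Proof. by move=> fd ge; rewrite -(mulrfctE f g); exact: is_deriveM. Qed.

(** * The substitution function [radius] *)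

Section Radius.
Context (R : realType) (p : nat).
Hypothesis podd : odd p.

(** The point with coordinates [1 / radius w] and [w / radius w] runs over the right half of the
    curve [x^(p+1) + z^(p+1) = 1], the profile of the unit sphere. As [p] is odd, the base is at
    least 1 for every real [w]. *)
Definition radius (w : R) : R := (1 + w ^+ p.+1) `^ p.+1%:R^-1.

Let evenX_ge0 (w : R) : 0 <= w ^+ p.+1.
Proof. by apply: exprn_even_ge0; rewrite /= podd. Qed.

Lemma radius_gt0 (w : R) : 0 < radius w.
Proof. by apply: powR_gt0; rewrite ltr_pwDl. Qed.

Let radius_neq0 (w : R) : radius w != 0.
Proof. by rewrite gt_eqF ?radius_gt0. Qed.

Lemma radiusX (w : R) : radius w ^+ p.+1 = 1 + w ^+ p.+1.
Proof.
rewrite -powR_mulrn ?powR_ge0// -powRrM mulVf ?pnatr_eq0// powRr1//.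
by rewrite addr_ge0.
Qed.

Lemma radius_ge1 (w : R) : 1 <= radius w.
Proof.
by rewrite -(expr_ge1 (ltn0Sn p) (ltW (radius_gt0 w))) radiusX lerDl.
Qed.

Lemma radius_inj_ge0 (x w : R) : 0 <= x -> x ^+ p.+1 = 1 + w ^+ p.+1 -> radius w = x.
Proof.
move=> x0; rewrite -radiusX => /esym/eqP.
by rewrite eqrXn2 ?(ltW (radius_gt0 _))// => /eqP.
Qed.

Lemma radius0 : radius 0 = 1.
Proof. by apply: radius_inj_ge0 => //; rewrite expr1n expr0n addr0. Qed.

Lemma radius_norm (w : R) : radius `|w| = radius w.
Proof. by rewrite /radius -normrX ger0_norm. Qed.

Lemma normr_le_radius (w : R) : `|w| <= radius w.
Proof.
rewrite -(@ler_pXn2r _ p.+1)// ?nnegrE ?normr_ge0 ?(ltW (radius_gt0 _))//.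
by rewrite radiusX -normrX ger0_norm// lerDr.
Qed.

Lemma radius_lt (v w : R) : 0 <= v -> v < w -> radius v < radius w.
Proof.
move=> v0 vw; rewrite -(@ltr_pXn2r _ p.+1)// ?nnegrE ?(ltW (radius_gt0 _))//.
by rewrite !radiusX ltrD2l ltrXn2r.
Qed.

Lemma radius_surj (x : R) : 1 <= x -> exists2 w, 0 <= w & radius w = x.
Proof.
move=> x1; exists ((x ^+ p.+1 - 1) `^ p.+1%:R^-1); first exact: powR_ge0.
apply: radius_inj_ge0; first exact: le_trans x1.
rewrite -[in RHS]powR_mulrn ?powR_ge0// -powRrM mulVf ?pnatr_eq0// powRr1.
  by rewrite addrC subrK.
by rewrite subr_ge0 exprn_ege1.
Qed.

Lemma is_derive_radius (w : R) : is_derive w 1 radius (w ^+ p / radius w ^+ p).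
Proof.
have pos : 0 < 1 + w ^+ p.+1 by rewrite ltr_pwDl.
have dX : is_derive w 1 (fun x : R => 1 + x ^+ p.+1) (p.+1%:R * w ^+ p).
  apply: (is_derive_eq (is_derive_add (is_derive_cst (1 : R) w 1)
    (is_derive_exprn p.+1 (is_derive_id w 1)))).
  by rewrite add0r mulr1.
have dP := @is_derive1_comp R (fun x => x `^ p.+1%:R^-1) (fun x => 1 + x ^+ p.+1)
  w _ _ (is_derive1_powR p.+1%:R^-1 pos) dX.
apply: (is_derive_eq dP).
(* Removing the real power leaves an identity between rational expressions in [w] and [radius w]. *)
have -> : (1 + w ^+ p.+1) `^ (p.+1%:R^-1 - 1) = radius w / radius w ^+ p.+1.
  rewrite radiusX powRD ?(gt_eqF pos) ?implybT//.
  by rewrite powR_inv1// ltW.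
rewrite exprS; field.
by rewrite expf_neq0 ?radius_neq0 ?nat1r ?pnatr_eq0.
Qed.

Lemma radius_continuous : continuous radius.
Proof. by move=> w; exact: is_derive_continuous (is_derive_radius w). Qed.

End Radius.

(** * Bounded primitives on the whole line *)

Section Primitive.
Context (R : realType).
Local Notation mu := (@lebesgue_measure R).

(** By symmetry the integral is twice the one over the half-line, which is finite. *)
Lemma integrable_inv_oneDsqr :
  mu.-integrable setT (EFin \o (fun x : R => (1 + x ^+ 2)^-1)).
Proof.
have pos (x : R) : (0 <= (oneDsqr x)^-1)%R by rewrite invr_ge0 (le_trans ler01).
have meas : measurable_fun setT (fun x : R => (oneDsqr x)^-1).
  by apply: continuous_measurable_fun; exact: continuous_oneDsqrV.
apply/integrableP; split; first exact/measurable_EFinP.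
under eq_integral => x _ do rewrite /= ger0_norm ?pos//.
rewrite (@ge0_symfun_integralT R (fun x => (oneDsqr x)^-1)) //.
- by rewrite -set_itvcy integral0y_oneDsqr -EFinM ltry.
- exact: continuous_oneDsqrV.
- by move=> x; rewrite /= /oneDsqr sqrrN.
Qed.

(** Domination makes [g] integrable on the line, so its integral from minus infinity to [x] is a
    primitive bounded by the total integral; subtracting its value at 0 normalises it. The bound is
    what later makes [d1] finite. *)
Lemma bounded_primitive (g : R -> R) (K : R) :
  continuous g -> (forall x, 0 <= g x <= K / (1 + x ^+ 2)) ->
  exists G : R -> R, [/\ forall x : R, is_derive x 1 G (g x), G 0 = 0
    & has_ubound (range G)].
Proof.
move=> cg gK.
have ig : mu.-integrable setT (EFin \o g).
  have ik : mu.-integrable setT (EFin \o (fun x => K * (1 + x ^+ 2)^-1)).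
    have := integrableZl measurableT K integrable_inv_oneDsqr.
    by congr integrable; apply/funext => x /=; rewrite EFinM.
  apply: le_integrable ik => //.
  - by apply/measurable_EFinP; exact: continuous_measurable_fun.
  - move=> x _ /=; have /andP[g0 gle] := gK x.
    by rewrite lee_fin ger0_norm// (le_trans gle) ?ler_norm.
pose F x := (\int[mu]_(t in `]-oo, x]) g t)%R.
have dF x : derivable F x 1 /\ (F^`())%classic x = g x.
  (* Here [x + 1] is just some point to the right of [x]. *)
  apply: (@continuous_FTC1 R g -oo%O x (x + 1)); rewrite ?ltrDl ?ltNyr//.
    exact: integrableS ig.
  exact: cg.
exists (fun x => F x - F 0); split.
- move=> x; have [derF dFE] := dF x.
  have dFx : is_derive x 1 F (g x) by apply: DeriveDef => //; rewrite -derive1E.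
  by have := is_derive_add dFx (is_derive_cst (- F 0) x 1); rewrite addr0.
- by rewrite subrr.
- exists (fine (\int[mu]_(t in setT) (g t)%:E)%E - F 0) => _ [x _ <-].
  rewrite lerB// fine_le//.
  + by apply: integrable_fin_num => //; exact: integrableS ig.
  + exact: integrable_fin_num.
  + apply: ge0_subset_integral => //.
      by apply/measurable_EFinP; exact: continuous_measurable_fun.
    by move=> t _; rewrite lee_fin; case/andP: (gK t).
Qed.

End Primitive.

(** * Monotonicity, inverse, oddness and range of a primitive of a positive even function *)

Section IncreasingPrimitive.
Context (R : realType) (G g : R -> R).
Hypotheses (dG : forall x : R, is_derive x 1 G (g x)) (g_gt0 : forall x, 0 < g x).

Lemma primitive_continuous : continuous G.
Proof. by move=> x; exact: is_derive_continuous (dG x). Qed.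

Lemma primitive_lt (x y : R) : x < y -> G x < G y.
Proof.
move=> xy; have [|z _ Gxy] := @MVT R G g x y xy (fun z _ => dG z).
  exact: continuous_subspaceT primitive_continuous.
by rewrite -subr_gt0 Gxy mulr_gt0// subr_gt0.
Qed.

Lemma primitive_le (x y : R) : x <= y -> G x <= G y.
Proof. by rewrite le_eqVlt => /predU1P[->//|/primitive_lt/ltW]. Qed.

Lemma primitive_lt_mono : {mono G : x y / x < y}.
Proof.
move=> x y; apply/idP/idP; last exact: primitive_lt.
by apply: contraTT; rewrite -!leNgt; exact: primitive_le.
Qed.

Lemma primitive_inj : injective G.
Proof.
move=> x y Gxy; apply/eqP; rewrite eq_le !leNgt.
by apply/andP; split; apply/negP => /primitive_lt; rewrite Gxy ltxx.
Qed.

(** A total function: outside the range of [G] it takes the default value 0. *)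
Definition primitive_inv (y : R) : R := xget 0 [set x | G x = y].

Lemma primitiveK : cancel G primitive_inv.
Proof.
by move=> x; apply: primitive_inj; apply: (@xgetPex _ 0 [set z | G z = G x]); exists x.
Qed.

Lemma is_derive_primitive_inv (x : R) :
  is_derive (G x) 1 primitive_inv (g x)^-1.
Proof.
apply: is_derive_inverse; last by rewrite gt_eqF.
- by near=> z; exact: primitiveK.
- by near=> z; exact: primitive_continuous.
Unshelve. all: by end_near. Qed.

Hypotheses (G0 : G 0 = 0) (g_even : forall x, g (- x) = g x).
Hypothesis ubG : has_ubound (range G).

(** Since [g] is even, [G z + G (- z)] has zero derivative; it is constant and vanishes at 0. *)
Lemma primitiveN (x : R) : G (- x) = - G x.
Proof.
have dGN (y : R) : is_derive y 1 (fun z => G z + G (- z)) 0.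
  have dN := @is_derive1_comp R G -%R y _ _ (dG (- y)) (is_deriveNid y 1).
  by have := is_derive_add (dG y) dN; rewrite g_even mulrN1 subrr.
have := is_derive_0_is_cst x 0 dGN; rewrite oppr0 !G0 addr0 => /eqP.
by rewrite addrC addr_eq0 => /eqP.
Qed.

Lemma primitive_norm (x : R) : G `|x| = `|G x|.
Proof.
have [x0|x0] := leP 0 x.
  by rewrite ger0_norm ?ger0_norm// -G0 primitive_le.
by rewrite !ltr0_norm ?primitiveN// -G0 primitive_lt.
Qed.

Lemma primitive_cvgy : G x @[x --> +oo] --> sup (range G).
Proof. by apply: nondecreasing_cvgr => // x y; exact: primitive_le. Qed.

(** The supremum is not attained because [G x < G (x + 1)]. *)
Lemma primitive_lt_sup (x : R) : G x < sup (range G).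
Proof.
have /primitive_lt /lt_le_trans : x < x + 1 by rewrite ltrDl.
by apply; apply: ub_le_sup => //; exists (x + 1).
Qed.

(** Some [x] satisfies [|y| < G x]; by oddness the values of [G] at [- x] and [x] bracket [y], and
    the intermediate value theorem applies. *)
Lemma primitive_surj (y : R) : `|y| < sup (range G) -> exists x, G x = y.
Proof.
move=> ylt; have hs : has_sup (range G) by split=> //; exists (G 0), 0.
have e0 : 0 < sup (range G) - `|y| by rewrite subr_gt0.
have [_ [x _ <-] yx] := sup_adherent e0 hs.
rewrite subKr in yx.
have x0 : 0 <= x.
  by rewrite leNgt; apply/negP => /primitive_lt; rewrite G0 ltNge (le_trans _ (ltW yx)).
have [|||z _ zy] := @IVT R G (- x) x y.
- by rewrite ge0_cp.
- exact: continuous_subspaceT primitive_continuous.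
- rewrite primitiveN; have Gx0 : 0 <= G x by rewrite -G0 primitive_le.
  rewrite (min_idPl _) ?(max_idPr _) ?ge0_cp//.
  by rewrite -ler_norml ltW.
- by exists z.
Qed.

End IncreasingPrimitive.

(** * The integral [J] under the substitution [rho = c * radius w] *)

Section ArcHeight.
Context (R : realType) (m p : nat) (c : R).
Hypotheses (mp : (2 * m = p.+1)%N) (podd : odd p) (c_gt0 : 0 < c).
Local Notation mu := (@lebesgue_measure R).
Local Notation radius := (@radius R p).

Let c_ge0 : 0 <= c := ltW c_gt0.

Lemma JintegrandE (x : R) : Jintegrand m c x =
  c ^+ p * (x ^+ p.+1 - c ^+ p.+1) `^ (- (p%:R / p.+1%:R)).
Proof. by rewrite /Jintegrand mp subn1. Qed.

Lemma Jintegrand_ge0 (x : R) : 0 <= Jintegrand m c x.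
Proof. by rewrite JintegrandE mulr_ge0 ?powR_ge0// exprn_ge0. Qed.

(** At [c * radius w] the difference under the power is [(c * w)^(p+1)], so the real power becomes
    [(c * w)^(-p)] and the factor [c^p] cancels. *)
Lemma Jintegrand_radius (w : R) : 0 < w -> Jintegrand m c (c * radius w) = (w ^+ p)^-1.
Proof.
move=> w0; rewrite JintegrandE exprMn (radiusX podd).
have -> : c ^+ p.+1 * (1 + w ^+ p.+1) - c ^+ p.+1 = (c * w) ^+ p.+1.
  by rewrite exprMn; ring.
have cw0 : 0 <= c * w by rewrite mulr_ge0 ?ltW.
rewrite powRN -[(c * w) ^+ _]powR_mulrn// -powRrM mulrC (mulrC p%:R) mulVKf ?pnatr_eq0//.
by rewrite powR_mulrn// exprMn invfM mulrAC mulVf ?mul1r// expf_neq0// gt_eqF.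
Qed.

Lemma Jintegrand_continuous (x : R) : c < x -> {for x, continuous (Jintegrand m c)}.
Proof.
move=> cx; have pos : 0 < x ^+ p.+1 - c ^+ p.+1.
  by rewrite subr_gt0 ltrXn2r.
have dX := is_derive_add (is_derive_exprn p.+1 (is_derive_id x 1))
  (is_derive_cst (- c ^+ p.+1) x 1).
have dP := @is_derive1_comp R (fun y => y `^ (- (p%:R / p.+1%:R)))
  (fun y => y ^+ p.+1 - c ^+ p.+1) x _ _ (is_derive1_powR _ pos) dX.
have := is_derive_continuous (is_derive_mul (is_derive_cst (c ^+ p) x 1) dP).
by congr continuous_at; apply/funext => y; rewrite JintegrandE.
Qed.

Lemma crad_surj (x : R) : c <= x -> exists2 w, 0 <= w & c * radius w = x.
Proof.
move=> cx; have [|w w0 wx] := @radius_surj R p podd (c^-1 * x).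
  by rewrite ler_pdivlMl// mulr1.
by exists w; rewrite // wx mulVKf ?gt_eqF.
Qed.

(** The inverse of the substitution. As [radius] is even, the condition [0 <= w] selects one of two
    roots; below [c] the default is 0. *)
Definition crad_inv (x : R) : R := xget 0 [set w | 0 <= w /\ c * radius w = x].

Lemma crad_lt (v w : R) : 0 <= v -> v < w -> c * radius v < c * radius w.
Proof. by move=> v0 vw; rewrite ltr_pM2l ?radius_lt. Qed.

Lemma crad_le (v w : R) : 0 <= v -> v <= w -> c * radius v <= c * radius w.
Proof. by move=> v0; rewrite le_eqVlt => /predU1P[->//|/(crad_lt v0)/ltW]. Qed.

Lemma crad_lt_mono (v w : R) : 0 <= v -> 0 <= w -> (c * radius v < c * radius w) = (v < w).
Proof.
move=> v0 w0; apply/idP/idP; last exact: crad_lt.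
by apply: contraTT; rewrite -!leNgt; exact: crad_le.
Qed.

Lemma cradK (w : R) : 0 <= w -> crad_inv (c * radius w) = w.
Proof.
move=> w0; have [v0 /eqP] := @xgetPex _ 0 [set v | 0 <= v /\ c * radius v = c * radius w]
  (ex_intro _ w (conj w0 erefl)).
rewrite -/(crad_inv _) eq_le !leNgt !crad_lt_mono// -!leNgt => vw.
by apply/eqP; rewrite eq_le.
Qed.

Lemma is_derive_crad (w : R) :
  is_derive w 1 (fun x => c * radius x) (c * (w ^+ p / radius w ^+ p)).
Proof.
have := is_derive_mul (is_derive_cst c w 1) (is_derive_radius podd w).
by rewrite mulr0 addr0.
Qed.

(** The case [w = 0] is excluded: there [c * radius w] has derivative zero. *)
Lemma is_derive_crad_inv (w : R) : 0 < w ->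
  is_derive (c * radius w) 1 crad_inv (c * (w ^+ p / radius w ^+ p))^-1.
Proof.
move=> w0; apply: (@is_derive_inverse R (fun x => c * radius x)).
- near=> z; apply: cradK; near: z.
  by apply: filterS (lt_nbhsr w0) => z /ltW.
- by near=> z; exact: is_derive_continuous (is_derive_crad z).
- exact: is_derive_crad.
- have r0 := radius_gt0 podd w.
  by rewrite !mulf_neq0 ?invr_eq0 ?expf_neq0// gt_eqF.
Unshelve. all: by end_near. Qed.

Context (G : R -> R).
Hypothesis dG : forall x : R, is_derive x 1 G (c / radius x ^+ p).
Hypothesis G0 : G 0 = 0.

(** The change of variables, done on primitives: the quotient of [c / radius w ^+ p] by the
    derivative of [c * radius w] is [w^(-p)], which is the integrand. *)
Lemma is_derive_primitive_crad_inv (w : R) : 0 < w ->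
  is_derive (c * radius w) 1 (G \o crad_inv) (Jintegrand m c (c * radius w)).
Proof.
move=> w0; have dV := is_derive_crad_inv w0.
have dGw : is_derive (crad_inv (c * radius w)) 1 G (c / radius w ^+ p).
  by rewrite cradK// ltW.
apply: (is_derive_eq (is_derive1_comp dGw dV)).
rewrite Jintegrand_radius//; have r0 := radius_gt0 podd w; field.
by rewrite !expf_neq0 ?gt_eqF.
Qed.

(** Taking [0 < v] keeps the interval strictly to the right of the singularity [c], so the
    fundamental theorem of calculus applies. *)
Lemma integral_Jintegrand_radius (v w : R) : 0 < v -> v < w ->
  (\int[mu]_(x in `[(c * radius v)%R, (c * radius w)%R]) (Jintegrand m c x)%:E
   = (G w - G v)%:E)%E.
Proof.
move=> v0 vw; have w0 := lt_trans v0 vw.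
have dF (x : R) : c < x -> is_derive x 1 (G \o crad_inv) (Jintegrand m c x).
  move=> cx; have [z z0 zx] := crad_surj (ltW cx).
  rewrite -zx; apply: is_derive_primitive_crad_inv.
  rewrite lt_neqAle z0 andbT; apply/eqP => z0'.
  by move: cx; rewrite -zx -z0' radius0// mulr1 ltxx.
have cv : c < c * radius v by have := crad_lt (lexx 0) v0; rewrite radius0// mulr1.
have cw := lt_trans cv (crad_lt (ltW v0) vw).
transitivity ((G \o crad_inv) (c * radius w)%R - (G \o crad_inv) (c * radius v)%R)%:E;
  last by rewrite /= !cradK// ltW.
apply: continuous_FTC2.
- exact: crad_lt (ltW v0) vw.
- apply: continuous_in_subspaceT => x; rewrite inE/= in_itv/= => /andP[vx _].
  exact: Jintegrand_continuous (lt_le_trans cv vx).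
- split.
  + move=> x; rewrite in_itv/= => /andP[vx _].
    by have [] := dF x (lt_trans cv vx).
  + have dFx := dF _ cv; have := is_derive_continuous dFx; exact: cvg_at_right_filter.
  + have dFx := dF _ cw; have := is_derive_continuous dFx; exact: cvg_at_left_filter.
- move=> x; rewrite in_itv/= => /andP[vx _].
  by have [_ <-] := dF x (lt_trans cv vx); rewrite derive1E.
Qed.

Lemma measurable_Jintegrand : measurable_fun setT (Jintegrand m c).
Proof.
have -> : Jintegrand m c = fun x =>
    c ^+ p * (x ^+ p.+1 - c ^+ p.+1) `^ (- (p%:R / p.+1%:R)).
  by apply/funext => x; rewrite JintegrandE.
apply: measurable_funM => //.
apply: (@measurableT_comp _ _ _ _ _ _ (fun y : R => y `^ (- (p%:R / p.+1%:R)))).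
  exact: measurable_powR.
by apply: measurable_funB => //; exact: exprn_measurable.
Qed.

(* The integrand is singular at [c], so the integral is exhausted by the
   integrals over [[c * radius (w / k), c * radius w]]. *)
Lemma JextE (w : R) : 0 <= w -> Jext m c (c * radius w) = (G w)%:E.
Proof.
rewrite le_eqVlt => /predU1P[<-|w0].
  by rewrite radius0// mulr1 /Jext set_itv1 integral_set1 G0.
rewrite /Jext -integral_itv_obnd_cbnd; last first.
  by apply/measurable_EFinP; apply: measurable_funTS; exact: measurable_Jintegrand.
(* The shift by two gives [a k < w] already at [k = 0]. *)
pose a k : R := w / k.+2%:R.
have a0 k : 0 < a k by rewrite divr_gt0.
have aw k : a k < w by rewrite ltr_pdivrMr// ltr_pMr// ltr1n.
pose F k := [set` `[c * radius (a k), c * radius w]].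
have cra k : c < c * radius (a k) by have := crad_lt (lexx 0) (a0 k); rewrite radius0// mulr1.
have -> : [set` `]c, c * radius w]] = \bigcup_k F k.
  apply/seteqP; split=> [x/=|x [k _]]; rewrite /F/= !in_itv/= => /andP[x1 x2].
    have [z z0 zx] := crad_surj (ltW x1).
    have zgt0 : 0 < z.
      rewrite lt_neqAle z0 andbT; apply/eqP => z0'.
      by move: x1; rewrite -zx -z0' radius0// mulr1 ltxx.
    (* An index above [w / z] ensures [a k <= z]. *)
    exists (Num.bound (w / z)) => //=; rewrite in_itv/= x2 andbT -zx.
    apply: crad_le; first exact: ltW.
    rewrite /a ler_pdivrMr// mulrC -ler_pdivrMr//.
    rewrite (le_trans (ltW (archi_boundP _))) ?divr_ge0 ?ltW//.
    by rewrite ltr_nat ltnW.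
  by rewrite x2 andbT (lt_le_trans (cra k)).
have FG k : (\int[mu]_(x in F k) (Jintegrand m c x)%:E = (G w - G (a k))%:E)%E.
  exact: integral_Jintegrand_radius.
have cvgI : (\int[mu]_(x in F k) (Jintegrand m c x)%:E)%E @[k --> \oo]
    --> (\int[mu]_(x in \bigcup_k F k) (Jintegrand m c x)%:E)%E.
  apply: ge0_nondecreasing_set_cvg_integral.
  - apply/nondecreasing_seqP => k; rewrite subsetEset; apply: subset_itvr.
    rewrite bnd_simp; apply: crad_le; first exact: ltW.
    by rewrite /a ler_pM2l// lef_pV2 ?posrE// ler_nat.
  - by move=> k; exact: measurable_itv.
  - move=> k; apply/measurable_EFinP; apply: measurable_funTS.
    exact: measurable_Jintegrand.
  - by move=> k x _; rewrite lee_fin Jintegrand_ge0.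
(* Monotone convergence gave one limit of these integrals; continuity of [G] at 0 gives the other,
   [G w]. *)
apply: (cvg_unique (@ereal_hausdorff R) cvgI).
have -> : (fun k => \int[mu]_(x in F k) (Jintegrand m c x)%:E)%E =
    (fun k => (G w - G (a k))%:E) by apply/funext => k; exact: FG.
apply: cvg_EFin; first exact: nearW.
have cG := primitive_continuous dG (x := 0).
have a_to0 : a k @[k --> \oo] --> 0.
  rewrite -(mulr0 w); apply: cvgM; first exact: cvg_cst.
  have := @cvg_harmonic R; rewrite -cvg_shiftS; exact: cvg_trans.
rewrite -[X in _ --> X](subr0 (G w)) -[X in _ --> G w - X]G0.
by apply: cvgB; [exact: cvg_cst|exact: continuous_cvg].
Qed.

End ArcHeight.

(** * The profile [G], the limit [d1] and the bijectivity of [J] *)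

Section Profile.
Context (R : realType) (m p : nat) (c : R).
Hypotheses (mp : (2 * m = p.+1)%N) (podd : odd p) (p_ge2 : (2 <= p)%N).
Hypothesis c_gt0 : 0 < c.
Local Notation radius := (@radius R p).

Lemma speed_gt0 (w : R) : 0 < c / radius w ^+ p.
Proof. by rewrite divr_gt0// exprn_gt0// radius_gt0. Qed.

Lemma speed_even (w : R) : c / radius (- w) ^+ p = c / radius w ^+ p.
Proof. by rewrite -radius_norm// normrN radius_norm. Qed.

(** Both 1 and [|w|] are at most [radius w], so [1 + w^2] is at most [2 * radius w ^+ 2]; then
    [2 <= p] raises the exponent. *)
Lemma speed_le (w : R) : c / radius w ^+ p <= 2 * c / (1 + w ^+ 2).
Proof.
have r1 := radius_ge1 podd w.
have r2 : 1 + w ^+ 2 <= 2 * radius w ^+ 2.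
  rewrite mulrDl !mul1r lerD ?exprn_ege1//.
  by rewrite -(real_normK (num_real w)) lerXn2r ?nnegrE ?normr_le_radius// (le_trans ler01).
have rp : radius w ^+ 2 <= radius w ^+ p by exact: ler_weXn2l.
have r2_gt0 : 0 < radius w ^+ 2 by rewrite exprn_gt0 ?radius_gt0.
have s_gt0 : 0 < 1 + w ^+ 2 by rewrite ltr_pwDl ?sqr_ge0.
have rp_gt0 := lt_le_trans r2_gt0 rp.
rewrite ler_pdivrMr// mulrAC ler_pdivlMr// -mulrA mulrCA ler_pM2l//.
by rewrite (le_trans r2)// ler_pM2l.
Qed.

Lemma le_crad (w : R) : c <= c * radius w.
Proof. by rewrite -[leLHS]mulr1 ler_pM2l// radius_ge1. Qed.

Lemma exists_profile : exists G : R -> R,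
  [/\ forall x : R, is_derive x 1 G (c / radius x ^+ p), G 0 = 0
    & has_ubound (range G)].
Proof.
apply: (@bounded_primitive _ (fun x => c / radius x ^+ p) (2 * c)) => x.
  have rn : radius x ^+ p != 0 by rewrite expf_neq0// gt_eqF// radius_gt0.
  have dr := @is_deriveV R (fun y => radius y ^+ p) x _ 1 rn
    (is_derive_exprn p (is_derive_radius podd x)).
  exact: (is_derive_continuous (is_derive_mul (is_derive_cst c x 1) dr)).
by rewrite speed_le andbT ltW// speed_gt0.
Qed.

Context (G : R -> R).
Hypothesis dG : forall x : R, is_derive x 1 G (c / radius x ^+ p).
Hypothesis G0 : G 0 = 0.
Hypothesis ubG : has_ubound (range G).

Lemma JE (w : R) : J m c (c * radius w) = `|G w|.
Proof.
rewrite -(radius_norm podd) /J (JextE mp podd c_gt0 dG G0) ?normr_ge0//=.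
exact: (primitive_norm dG speed_gt0 G0 speed_even).
Qed.

Lemma Jext_fin_num (a : R) : c <= a -> Jext m c a \is a fin_num.
Proof. by move=> /(crad_surj podd c_gt0)[w w0 <-]; rewrite (JextE mp podd c_gt0 dG G0). Qed.

Lemma J_ge0E (w : R) : 0 <= w -> J m c (c * radius w) = G w.
Proof. by move=> w0; rewrite /J (JextE mp podd c_gt0 dG G0). Qed.

Lemma J_lt : {in `[c, +oo[ &, {homo J m c : x y / x < y}}.
Proof.
move=> x y; rewrite !in_itv/= !andbT.
move=> /(crad_surj podd c_gt0)[v v0 <-] /(crad_surj podd c_gt0)[w w0 <-].
rewrite crad_lt_mono// !J_ge0E// => vw.
exact: (primitive_lt dG speed_gt0).
Qed.

(** Beyond [c], [J] is [G] composed with [crad_inv], and [crad_inv] tends to infinity. *)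
Lemma J_cvg : J m c a @[a --> +oo] --> sup (range G).
Proof.
have cV : crad_inv p c a @[a --> +oo] --> +oo.
  apply/cvgryPge => A; near=> a.
  have ca : c * radius `|A| <= a by near: a; exact: nbhs_pinfty_ge (num_real _).
  have c0 : c <= a.
    exact: le_trans (le_crad _) ca.
  have [w w0 wa] := crad_surj podd c_gt0 c0.
  rewrite -wa (cradK podd c_gt0 w0) (le_trans (ler_norm A))// leNgt.
  apply/negP => /(crad_lt podd c_gt0 w0).
  by rewrite wa ltNge ca.
have := cvg_comp _ _ cV (primitive_cvgy dG speed_gt0 ubG).
apply: cvg_trans; apply: near_eq_cvg; near=> a.
have c0 : c <= a by near: a; exact: nbhs_pinfty_ge (num_real _).
have [w w0 <-] := crad_surj podd c_gt0 c0.
by rewrite /= (cradK podd c_gt0 w0) J_ge0E.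
Unshelve. all: by end_near. Qed.

Lemma d1E : d1 m c = sup (range G).
Proof. by apply/cvg_lim; [exact: Rhausdorff|exact: J_cvg]. Qed.

Lemma d1_gt0 : 0 < d1 m c.
Proof. by rewrite d1E -G0; exact: (primitive_lt_sup dG speed_gt0). Qed.

Lemma J_image : J m c @` [set x | c <= x] = [set y | 0 <= y < d1 m c].
Proof.
rewrite d1E; apply/seteqP; split=> [_ [x cx <-]|y /andP[y0 yd]].
  have [w w0 <-] := crad_surj podd c_gt0 cx.
  rewrite /= J_ge0E// (primitive_lt_sup dG speed_gt0)// andbT -G0.
  exact: (primitive_le dG speed_gt0).
have [|w wy] := @primitive_surj R G _ dG speed_gt0 G0 speed_even ubG y.
  by rewrite ger0_norm.
exists (c * radius w); first exact: le_crad.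
by rewrite JE wy ger0_norm.
Qed.

(** This determines alpha-hat from its defining equation. The sign of [w] is lost in [|G w|], but
    [radius] is even. *)
Lemma J_inj (x : R) (w : R) : c <= x -> J m c x = `|G w| -> x = c * radius w.
Proof.
move=> /(crad_surj podd c_gt0)[v v0 <-].
rewrite J_ge0E// -(primitive_norm dG speed_gt0 G0 speed_even).
by move=> /(primitive_inj dG speed_gt0) ->; rewrite radius_norm.
Qed.

End Profile.

Lemma near_eq_continuous (T U : topologicalType) (f g : T -> U) (x : T) :
  (\forall y \near x, f y = g y) -> {for x, continuous f} -> {for x, continuous g}.
Proof.
move=> fg cf; suff : g @ x --> f x by rewrite (nbhs_singleton fg).
by apply: cvg_trans cf; apply: near_eq_cvg; exact: fg.
Qed.

(** * Coordinates, limits and derivatives in three-space, and the gradient of [Phi] *)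

Section Vec3.
Context (R : realType).
Implicit Types (a b c : R).

Lemma cx_vec3 a b c : cx (vec3 a b c) = a.
Proof. by rewrite /cx /vec3 mxE inordK. Qed.

Lemma cy_vec3 a b c : cy (vec3 a b c) = b.
Proof. by rewrite /cy /vec3 mxE inordK. Qed.

Lemma cz_vec3 a b c : cz (vec3 a b c) = c.
Proof. by rewrite /cz /vec3 mxE inordK. Qed.

Lemma rV3_eq (x y : 'rV[R]_3) : cx x = cx y -> cy x = cy y -> cz x = cz y -> x = y.
Proof.
rewrite /cx /cy /cz => x0 x1 x2; apply/rowP => -[[|[|[|//]]] i3].
- by rewrite (_ : Ordinal i3 = inord 0)//; apply/val_inj; rewrite /= inordK.
- by rewrite (_ : Ordinal i3 = inord 1)//; apply/val_inj; rewrite /= inordK.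
- by rewrite (_ : Ordinal i3 = inord 2)//; apply/val_inj; rewrite /= inordK.
Qed.

Lemma scale_vec3 k a b c : k *: vec3 a b c = vec3 (k * a) (k * b) (k * c).
Proof.
by apply: rV3_eq; rewrite ?cx_vec3 ?cy_vec3 ?cz_vec3 /cx /cy /cz /vec3 !mxE !inordK.
Qed.

Lemma add_vec3 a b c a' b' c' :
  vec3 a b c + vec3 a' b' c' = vec3 (a + a') (b + b') (c + c').
Proof.
by apply: rV3_eq; rewrite ?cx_vec3 ?cy_vec3 ?cz_vec3 /cx /cy /cz /vec3 !mxE !inordK.
Qed.

Lemma cross_vec3 a b c a' b' c' : cross (vec3 a b c) (vec3 a' b' c') =
  vec3 (b * c' - c * b') (c * a' - a * c') (a * b' - b * a').
Proof. by rewrite /cross !cx_vec3 !cy_vec3 !cz_vec3. Qed.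

Lemma cvg_vec3 (T : Type) (F : set_system T) {FF : Filter F} (f g h : T -> R) a b c :
  f @ F --> a -> g @ F --> b -> h @ F --> c ->
  (fun t => vec3 (f t) (g t) (h t)) @ F --> vec3 a b c.
Proof.
(* Expanding in the standard basis reduces the claim to limits of sums and scalar multiples. *)
have vE x y z : vec3 x y z = x *: vec3 1 0 0 + y *: vec3 0 1 0 + z *: vec3 0 0 (1 : R).
  by rewrite !scale_vec3 !add_vec3 !mulr0 !mulr1 !addr0 !add0r.
move=> fa gb hc; rewrite vE; under eq_fun do rewrite vE.
by apply: cvgD; [apply: cvgD|]; apply: cvgZr_tmp.
Qed.

Lemma is_derive_vec3 (f g h : R -> R) (x a b c : R) :
  is_derive x 1 f a -> is_derive x 1 g b -> is_derive x 1 h c ->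
  is_derive x 1 (fun t => vec3 (f t) (g t) (h t)) (vec3 a b c).
Proof.
move=> fa gb hc.
have entry (i : 'I_1) (j : 'I_3) :
    is_derive x 1 (fun t => vec3 (f t) (g t) (h t) i j) (vec3 a b c i j).
  case: j => -[|[|[|//]]] j3; rewrite mxE /=;
  by under [X in is_derive _ _ X]eq_fun do rewrite mxE /=.
have der : derivable (fun t => vec3 (f t) (g t) (h t)) x 1.
  by apply/derivable_mxP => i j; have [] := entry i j.
apply: DeriveDef => //; rewrite derive_mx//.
by apply/matrixP => i j; rewrite mxE; have [_] := entry i j.
Qed.

Lemma is_derive_coord (i : 'I_1) (j : 'I_3) (x v : 'rV[R]_3) :
  is_derive x v (fun y : 'rV[R]_3 => y i j) (v i j).
Proof.
have der := @derivable_id R _ x v.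
apply: DeriveDef; first by have /derivable_mxP := der; exact.
have := derive_mx der; rewrite derive_id => /matrixP/(_ i j).
by rewrite mxE => <-.
Qed.

Lemma is_derive_Phi (m : nat) (x v : 'rV[R]_3) : is_derive x v (Phi m)
  (2 * m%:R * ((cx x ^+ 2 + cy x ^+ 2) ^+ m.-1 * (cx x * cx v + cy x * cy v)
    + cz x ^+ (2 * m).-1 * cz v)).
Proof.
have dxy := is_derive_add (is_derive_exprn 2 (is_derive_coord ord0 (inord 0) x v))
  (is_derive_exprn 2 (is_derive_coord ord0 (inord 1) x v)).
apply: (is_derive_eq (is_derive_add (is_derive_exprn m dxy)
  (is_derive_exprn (2 * m) (is_derive_coord ord0 (inord 2) x v)))).
by rewrite /cx /cy /cz natrM !expr1; ring.
Qed.

Lemma gradPhi_vec3 (m : nat) a b c : gradPhi m (vec3 a b c) =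
  (2 * m%:R) *: vec3 ((a ^+ 2 + b ^+ 2) ^+ m.-1 * a)
                     ((a ^+ 2 + b ^+ 2) ^+ m.-1 * b) (c ^+ (2 * m).-1).
Proof.
have gE i : gradPhi m (vec3 a b c) 0 i =
    (2 * m%:R) * ((a ^+ 2 + b ^+ 2) ^+ m.-1 *
      (a * (inord 0 == i)%:R + b * (inord 1 == i)%:R)
      + c ^+ (2 * m).-1 * (inord 2 == i)%:R).
  have [_ dE] := is_derive_Phi m (vec3 a b c) (delta_mx 0 i).
  by rewrite mxE dE cx_vec3 cy_vec3 cz_vec3 /cx /cy /cz !mxE.
rewrite scale_vec3; apply: rV3_eq.
- by rewrite cx_vec3 /cx gE -!val_eqE /= !inordK//= !mulr0 !addr0 mulr1.
- by rewrite cy_vec3 /cy gE -!val_eqE /= !inordK//= !mulr0 add0r addr0 mulr1.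
- by rewrite cz_vec3 /cz gE -!val_eqE /= !inordK//= !mulr0 addr0 mulr0 add0r mulr1.
Qed.

End Vec3.

(** * The rotational surface and its Birkhoff-Gauss map *)

Section Catenoid.
Context (R : realType) (m p : nat) (c c3 : R).
Hypotheses (mp : (2 * m = p.+1)%N) (podd : odd p).
Hypothesis c_gt0 : 0 < c.
Local Notation radius := (@radius R p).
Context (G : R -> R).
Hypothesis dG : forall x : R, is_derive x 1 G (c / radius x ^+ p).
Hypothesis G0 : G 0 = 0.
Hypothesis ubG : has_ubound (range G).

Let G_lt_mono := primitive_lt_mono dG (speed_gt0 podd c_gt0).
Let G_surj := primitive_surj dG (speed_gt0 podd c_gt0) G0 (speed_even c podd) ubG.
Let d1G : d1 m c = sup (range G) := d1E mp podd c_gt0 dG G0 ubG.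

(* This is [w u]; the name refers to the slope of the Birkhoff-Gauss map [BG] below. *)
Definition ratio (u : R) : R := primitive_inv G (u - c3).

(** The domain is open, so formulas valid on it may be differentiated there. *)
Lemma near_domain (u : R) : `|u - c3| < d1 m c -> \forall z \near u, `|z - c3| < d1 m c.
Proof.
move=> uD; have : {for u, continuous (fun z : R => `|z - c3|)}.
  apply: continuous_comp; last exact: norm_continuous.
  by apply: cvgB; [exact: cvg_id|exact: cvg_cst].
by move=> /(_ _ (lt_nbhsl uD)).
Qed.

Lemma primitive_ratio (u : R) : `|u - c3| < d1 m c -> G (ratio u) = u - c3.
Proof. by rewrite d1G => /G_surj ex; exact: (xgetPex 0 ex). Qed.

Lemma is_derive_ratio (u : R) : `|u - c3| < d1 m c ->
  is_derive u 1 ratio (radius (ratio u) ^+ p / c).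
Proof.
move=> uD; have dW := is_derive_primitive_inv dG (speed_gt0 podd c_gt0) (ratio u).
rewrite primitive_ratio// in dW.
have dS := is_derive_add (is_derive_id u 1) (is_derive_cst (- c3) u 1).
apply: (is_derive_eq (@is_derive1_comp R (primitive_inv G) (fun z => z - c3) u _ _ dW dS)).
by rewrite addr0 mulr1 invf_div.
Qed.

Lemma ratio_c3 : ratio c3 = 0.
Proof.
by rewrite /ratio subrr -[X in primitive_inv G X]G0 (primitiveK dG (speed_gt0 podd c_gt0)).
Qed.

Context (ah : R -> R).
Hypothesis ahP : forall u, `|u - c3| < d1 m c -> c <= ah u /\ J m c (ah u) = `|u - c3|.

Lemma ahE (u : R) : `|u - c3| < d1 m c -> ah u = c * radius (ratio u).
Proof.
move=> uD; have [cu Ju] := ahP uD.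
by apply: (J_inj mp podd c_gt0 dG G0 cu); rewrite Ju primitive_ratio.
Qed.

Lemma near_ahE (u : R) : `|u - c3| < d1 m c ->
  \forall z \near u, c * radius (ratio z) = ah z.
Proof. by move=> /near_domain; apply: filterS => z /ahE. Qed.

(** In the chain rule the factors [radius ^+ p] and [c] cancel. The result is smooth across [c3],
    where [J] itself has a singular integrand. *)
Lemma is_derive_ah (u : R) : `|u - c3| < d1 m c -> is_derive u 1 ah (ratio u ^+ p).
Proof.
move=> uD; apply: (near_eq_is_derive (near_ahE uD)).
have dA := @is_derive1_comp R _ ratio u _ _ (is_derive_crad c podd (ratio u)) (is_derive_ratio uD).
apply: (is_derive_eq dA); field.
by rewrite expf_neq0 ?gt_eqF// radius_gt0.
Qed.

Lemma derive1_ah (u : R) : `|u - c3| < d1 m c -> derive1 ah u = ratio u ^+ p.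
Proof. by move=> /is_derive_ah[_ <-]; rewrite derive1E. Qed.

Lemma is_derive_derive1_ah (u : R) : `|u - c3| < d1 m c ->
  is_derive u 1 (derive1 ah) (p%:R * ratio u ^+ p.-1 * (radius (ratio u) ^+ p / c)).
Proof.
move=> uD; apply: (near_eq_is_derive _ (is_derive_exprn p (is_derive_ratio uD))).
by apply: filterS (near_domain uD) => z /derive1_ah.
Qed.

Lemma derive2_ah (u : R) : `|u - c3| < d1 m c ->
  derive1 (derive1 ah) u = p%:R * ratio u ^+ p.-1 * (radius (ratio u) ^+ p / c).
Proof. by move=> /is_derive_derive1_ah[_ <-]; rewrite derive1E. Qed.

Lemma ratio_continuous (u : R) : `|u - c3| < d1 m c -> {for u, continuous ratio}.
Proof. by move=> /is_derive_ratio; exact: is_derive_continuous. Qed.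

Lemma derive2_ah_continuous (u : R) : `|u - c3| < d1 m c ->
  {for u, continuous (derive1 (derive1 ah))}.
Proof.
move=> uD.
have dh := is_derive_mul (is_derive_mul (is_derive_cst (p%:R : R) (ratio u) 1)
    (is_derive_exprn p.-1 (is_derive_id (ratio u) 1)))
  (is_derive_mul (is_derive_exprn p (is_derive_radius podd (ratio u)))
    (is_derive_cst c^-1 (ratio u) 1)).
have := continuous_comp (ratio_continuous uD) (is_derive_continuous dh).
apply: near_eq_continuous.
by apply: filterS (near_domain uD) => z /derive2_ah ->.
Qed.

Lemma ah_gt (w u : R) : 0 <= w -> `|u - c3| < d1 m c -> G w < `|u - c3| ->
  c * radius w < ah u.
Proof.
move=> w0 uD wu; rewrite ahE// -(radius_norm podd (ratio u)) crad_lt//.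
rewrite -G_lt_mono (primitive_norm dG (speed_gt0 podd c_gt0) G0 (speed_even c podd)).
by rewrite primitive_ratio.
Qed.

(** One statement for both ends of the interval. Once [|u - c3|] exceeds [G (|A| / c)], [ah u]
    exceeds [c * radius (|A| / c)], which is at least [|A|]. *)
Lemma ah_cvgy (F : set_system R) (FF : Filter F) :
  (forall e, e < d1 m c -> \forall u \near F, e < `|u - c3| < d1 m c) -> ah @ F --> +oo.
Proof.
move=> FD; apply/cvgryPge => A.
have GA : G `|A| < d1 m c by rewrite d1G; exact: (primitive_lt_sup dG (speed_gt0 podd c_gt0)).
have cG : G (`|A| / c) < d1 m c.
  by rewrite d1G; exact: (primitive_lt_sup dG (speed_gt0 podd c_gt0)).
apply: filterS (FD _ cG) => u /andP[uA uD].
have A0 : 0 <= `|A| / c by rewrite divr_ge0// ltW.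
rewrite (le_trans _ (ltW (ah_gt A0 uD uA)))// (le_trans (ler_norm _))//.
by rewrite -ler_pdivrMl// mulrC (le_trans (ler_norm _))// normr_le_radius.
Qed.

(** The horizontal part points to the axis, as does that of the cross product of the partial
    derivatives. The formula includes [u = c3], where [ratio] is 0, so the extension requires no
    separate case. *)
Definition BG (u v : R) : 'rV[R]_3 :=
  vec3 (- (radius (ratio u))^-1 * cos v) (- (radius (ratio u))^-1 * sin v)
       (ratio u / radius (ratio u)).

Let fh u v := vec3 (ah u * cos v) (ah u * sin v) u.

Let r_neq0 w : radius w != 0.
Proof. by rewrite gt_eqF// radius_gt0. Qed.

Lemma pd_u_fh (u v : R) : `|u - c3| < d1 m c ->
  pd_u fh u v = vec3 (ratio u ^+ p * cos v) (ratio u ^+ p * sin v) 1.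
Proof.
move=> uD; have da := is_derive_ah uD.
have dx k := is_derive_mul da (is_derive_cst k u 1).
rewrite /pd_u derive1E; have [_ ->] := is_derive_vec3 (dx (cos v)) (dx (sin v)) (is_derive_id u 1).
by rewrite !mulr0 !add0r ![_ * ratio u ^+ p]mulrC.
Qed.

Lemma pd_v_fh (u v : R) : pd_v fh u v = vec3 (- (ah u * sin v)) (ah u * cos v) 0.
Proof.
have dx := is_derive_mul (is_derive_cst (ah u) v 1) (is_derive_cos v).
have dy := is_derive_mul (is_derive_cst (ah u) v 1) (is_derive_sin v).
rewrite /pd_v derive1E; have [_ ->] := is_derive_vec3 dx dy (is_derive_cst u v 1).
by rewrite !mulr0 !addr0 mulrN.
Qed.

Lemma is_derive_BG_u (u v : R) : `|u - c3| < d1 m c ->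
  is_derive u 1 (fun s => BG s v)
    ((c * radius (ratio u) ^+ 2)^-1 *: vec3 (ratio u ^+ p * cos v) (ratio u ^+ p * sin v) 1).
Proof.
move=> uD; have dw := is_derive_ratio uD; set w := ratio u in dw *.
have dr := @is_derive1_comp R _ ratio u _ _ (is_derive_radius podd (ratio u)) dw.
have dV := @is_deriveV R (radius \o ratio) u _ 1 (r_neq0 w) dr.
have dx k := is_derive_mul (is_deriveN dV) (is_derive_cst k u 1).
have dz := is_derive_mul dw dV.
apply: (is_derive_eq (is_derive_vec3 (dx (cos v)) (dx (sin v)) dz)).
have c_neq0 : c != 0 by rewrite gt_eqF.
rewrite scale_vec3 -/w /=; congr vec3.
- rewrite /GRing.scale /=; field. by rewrite ?expf_neq0 ?r_neq0 ?c_neq0.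
- rewrite /GRing.scale /=; field. by rewrite ?expf_neq0 ?r_neq0 ?c_neq0.
- have rX := radiusX podd w; rewrite !exprS in rX.
  rewrite /GRing.scale /=.
  (* The vertical component relies on the relation defining [radius]; with 1 so expressed, the
     identity is purely rational. *)
  have -> : 1 = radius w * radius w ^+ p - w * w ^+ p by rewrite rX addrK.
  by field; rewrite ?expf_neq0 ?r_neq0 ?c_neq0.
Qed.

Lemma is_derive_BG_v (u v : R) : is_derive v 1 (BG u)
  ((radius (ratio u))^-1 *: vec3 (sin v) (- cos v) 0).
Proof.
set r := (radius (ratio u))^-1.
have dx := is_derive_mul (is_derive_cst (- r) v 1) (is_derive_cos v).
have dy := is_derive_mul (is_derive_cst (- r) v 1) (is_derive_sin v).
apply: (is_derive_eq (is_derive_vec3 dx dy (is_derive_cst (ratio u * r) v 1))).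
by rewrite scale_vec3 !mulr0 !addr0 mulrNN mulrN mulNr.
Qed.

Lemma pd_u_BG (u v : R) : `|u - c3| < d1 m c ->
  pd_u BG u v = (c * radius (ratio u) ^+ 2)^-1 *: pd_u fh u v.
Proof.
move=> uD; rewrite pd_u_fh// /pd_u derive1E.
by have [_ ->] := is_derive_BG_u v uD.
Qed.

(** Because [ah u = c * radius (ratio u)], the factor [1 / radius] is [ah u] times the coefficient
    found for [pd_u]; the inward horizontal part yields the opposite sign. *)
Lemma pd_v_BG (u v : R) : `|u - c3| < d1 m c ->
  pd_v BG u v = - (c * radius (ratio u) ^+ 2)^-1 *: pd_v fh u v.
Proof.
move=> uD; rewrite pd_v_fh /pd_v derive1E; have [_ ->] := is_derive_BG_v u v.
have c_neq0 : c != 0 by rewrite gt_eqF.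
by rewrite ahE// !scale_vec3 mulr0; congr vec3; field; rewrite c_neq0 r_neq0.
Qed.

Let D := [set q : R * R | `|q.1 - c3| < d1 m c].

Lemma BG_is_BG_map : is_BG_map m fh BG D.
Proof.
move=> u v /= uD; set w := ratio u; set r := (radius w)^-1.
have r0 : 0 < r by rewrite invr_gt0 radius_gt0.
have cs := cos2Dsin2 v.
have xy : (- r * cos v) ^+ 2 + (- r * sin v) ^+ 2 = r ^+ 2.
  by rewrite !exprMn -mulrDr cs mulr1 sqrrN.
split.
  rewrite /Phi /BG cx_vec3 cy_vec3 cz_vec3 -/w -/r xy -exprM mp.
  by rewrite exprMn -{1}[r ^+ _]mul1r -mulrDl -(radiusX podd) -exprMn mulfV ?expr1n.
(* The horizontal part of the gradient has size [2 * m * r^p] and that of the cross product has size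
   [ah u]; [mu] is their quotient. *)
exists (2 * m%:R * r ^+ p / ah u); split.
  have [cu _] := ahP uD.
  have m0 : (0 < m)%N by case: (m) mp.
  apply: divr_gt0; last exact: lt_le_trans cu.
  by apply: mulr_gt0; [rewrite mulr_gt0// ltr0n|exact: exprn_gt0].
(* The exponents agree since [2 * (m - 1) + 1 = p]. *)
have rp : (r ^+ 2) ^+ m.-1 * r = r ^+ p.
  rewrite -exprM -exprSr; congr (_ ^+ _); apply/eqP.
  by rewrite -eqSS -mp; case: (m) mp => // k _; rewrite /= mulnS.
rewrite pd_u_fh// pd_v_fh cross_vec3 gradPhi_vec3 -/w -/r xy mp /= !scale_vec3.
have a0 : ah u != 0 by have [cu _] := ahP uD; rewrite gt_eqF// (lt_le_trans c_gt0).
have rx k : (r ^+ 2) ^+ m.-1 * (- r * k) = - r ^+ p * k by rewrite mulrA mulrN rp.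
rewrite !rx exprMn; congr vec3.
- by field.
- by field.
- have -> : w ^+ p * cos v * (ah u * cos v) - w ^+ p * sin v * - (ah u * sin v) =
    w ^+ p * ah u.
    by rewrite -[RHS]mulr1 -cs; ring.
  by field.
Qed.

Lemma BG_minimal : mink_minimal fh BG D.
Proof.
move=> u v /= uD; set k := (c * radius (ratio u) ^+ 2)^-1.
exists k, 0, 0, (- k); rewrite pd_u_BG// pd_v_BG// !scale0r addr0 add0r.
by rewrite subrr.
Qed.

Lemma BG_C1 : C1_on BG D.
Proof.
move=> [u v] /= uD; split; first by have [] := is_derive_BG_u v uD.
split; first by have [] := is_derive_BG_v u v.
have cfst : (fun q : R * R => q.1) @ (u, v) --> u by exact: cvg_fst.
have nearD : \forall q \near (u, v), `|q.1 - c3| < d1 m c.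
  exact: cfst _ (near_domain uD).
have csnd : (fun q : R * R => q.2) @ (u, v) --> v by exact: cvg_snd.
have cw : (fun q : R * R => ratio q.1) @ (u, v) --> ratio u.
  exact: (continuous_cvg _ (ratio_continuous uD) cfst).
have cr : (fun q : R * R => radius (ratio q.1)) @ (u, v) --> radius (ratio u).
  by apply: continuous_cvg cw; exact: radius_continuous.
have cwp : (fun q : R * R => ratio q.1 ^+ p) @ (u, v) --> ratio u ^+ p.
  have cX := is_derive_continuous (is_derive_exprn p (is_derive_id (ratio u) 1)).
  exact: (continuous_cvg _ cX cw).
have ccos : (fun q : R * R => cos q.2) @ (u, v) --> cos v.
  by apply: continuous_cvg csnd; exact: continuous_cos.
have csin : (fun q : R * R => sin q.2) @ (u, v) --> sin v.
  by apply: continuous_cvg csnd; exact: continuous_sin.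
have ck : (fun q : R * R => (c * radius (ratio q.1) ^+ 2)^-1) @ (u, v) -->
    (c * radius (ratio u) ^+ 2)^-1.
  have k_neq0 : c * radius (ratio u) ^+ 2 != 0.
    by rewrite mulf_neq0 ?expf_neq0 ?r_neq0// gt_eqF.
  exact: (cvgV k_neq0 (cvgM (cvg_cst c) (cvgM cr cr))).
have crV : (fun q : R * R => (radius (ratio q.1))^-1) @ (u, v) --> (radius (ratio u))^-1.
  exact: (cvgV (r_neq0 _) cr).
split.
(* Near the point each partial derivative equals a closed form, continuous jointly in both
   variables. *)
- apply: (@near_eq_continuous _ _ (fun q : R * R => (c * radius (ratio q.1) ^+ 2)^-1 *:
    vec3 (ratio q.1 ^+ p * cos q.2) (ratio q.1 ^+ p * sin q.2) 1)).
    by apply: filterS nearD => q qD; rewrite pd_u_BG// pd_u_fh.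
  by apply: (cvgZ ck); exact: (cvg_vec3 (cvgM cwp ccos) (cvgM cwp csin) (cvg_cst (1 : R))).
- apply: (@near_eq_continuous _ _ (fun q : R * R => (radius (ratio q.1))^-1 *:
    vec3 (sin q.2) (- cos q.2) 0)).
    apply: filterS nearD => q _; rewrite /pd_v derive1E.
    by have [_ ->] := is_derive_BG_v q.1 q.2.
  by apply: (cvgZ crV); exact: (cvg_vec3 csin (cvgN ccos) (cvg_cst (0 : R))).
Qed.

End Catenoid.

(** * Assembly of the theorem with [p = 2m - 1] *)

Unset Implicit Arguments.

Theorem theorem4p2 (R : realType) (m : nat) (c2 c3 : R) :
  (2 <= m)%N -> 0 < c2 ->
  (* J(alpha) is finite for alpha >= c2, d1 = lim J is finite and positive *)
  (forall alpha : R, c2 <= alpha -> Jext m c2 alpha \is a fin_num) /\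
  J m c2 a @[a --> +oo] --> d1 m c2 /\
  0 < d1 m c2 /\
  (* J is a strictly increasing bijection [c2, oo) -> [0, d1) *)
  {in `[c2, +oo[ &, {homo J m c2 : x y / x < y}} /\
  J m c2 @` [set x | c2 <= x] = [set y | 0 <= y < d1 m c2] /\
  (* properties of alpha-hat and of the rotational surface f-hat *)
  (forall ah : R -> R,
     (forall u, `|u - c3| < d1 m c2 ->
        c2 <= ah u /\ J m c2 (ah u) = `|u - c3|) ->
     (forall u, `|u - c3| < d1 m c2 ->
        derivable ah u 1 /\ derivable (derive1 ah) u 1 /\
        {for u, continuous (derive1 (derive1 ah))}) /\
     derive1 ah c3 = 0 /\ derive1 (derive1 ah) c3 = 0 /\
     ah u @[u --> (c3 + d1 m c2)^'-] --> +oo /\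
     ah u @[u --> (c3 - d1 m c2)^'+] --> +oo /\
     exists eta : R -> R -> 'rV[R]_3,
       let fh := fun u v => vec3 (ah u * cos v) (ah u * sin v) u in
       let D := [set p : R * R | `|p.1 - c3| < d1 m c2] in
       is_BG_map m fh eta D /\ C1_on eta D /\ mink_minimal fh eta D).
Proof.
move=> m_ge2 c2_gt0.
pose p := (2 * m - 1)%N.
have mp : (2 * m = p.+1)%N by rewrite /p; lia.
have podd : odd p by have : ~~ odd p.+1; [rewrite -mp oddM|rewrite /= negbK].
have p_ge2 : (2 <= p)%N by rewrite /p; lia.
have [G [dG G0 ubG]] := exists_profile podd p_ge2 c2_gt0.
split; first by move=> a; exact: (Jext_fin_num mp podd c2_gt0 dG G0).
split; first by rewrite (d1E mp podd c2_gt0 dG G0 ubG); exact: (J_cvg mp podd c2_gt0 dG G0 ubG).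
split; first exact: (d1_gt0 mp podd c2_gt0 dG G0 ubG).
split; first exact: (J_lt mp podd c2_gt0 dG G0).
split; first exact: (J_image mp podd c2_gt0 dG G0 ubG).
move=> ah ahP.
have d1_gt0 := d1_gt0 mp podd c2_gt0 dG G0 ubG.
have c3D : `|c3 - c3| < d1 m c2 by rewrite subrr normr0.
split.
  move=> u uD; split; first by have [] := is_derive_ah mp podd c2_gt0 dG G0 ubG ahP uD.
  split; first by have [] := is_derive_derive1_ah mp podd c2_gt0 dG G0 ubG ahP uD.
  exact: (derive2_ah_continuous mp podd c2_gt0 dG G0 ubG ahP uD).
have r0 := ratio_c3 c3 podd c2_gt0 dG G0.
split.
  rewrite (derive1_ah mp podd c2_gt0 dG G0 ubG ahP c3D) r0 expr0n.
  by case: (p) p_ge2.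
split.
  (* The second derivative carries the factor [0 ^+ p.-1], which vanishes because [2 <= p]. *)
  rewrite (derive2_ah mp podd c2_gt0 dG G0 ubG ahP c3D) r0 expr0n.
  by case: (p) p_ge2 => [|[|k]]//; rewrite mulr0 mul0r.
split.
  apply: (ah_cvgy mp podd c2_gt0 dG G0 ubG ahP) => e ed; near=> u.
  (* Since [e] may be negative, the maximum with 0 also forces [c3 < u], which resolves the absolute
     value. *)
  have u1 : c3 + Num.max e 0 < u.
    by near: u; apply: nbhs_left_gt; rewrite ltrD2l gt_max ed.
  have u2 : u < c3 + d1 m c2 by near: u; exact: nbhs_left_lt.
  have um : Num.max e 0 < u - c3 by rewrite ltrBrDl.
  have [eu u0] : e < u - c3 /\ 0 < u - c3 by apply/andP; rewrite -gt_max.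
  by rewrite gtr0_norm// eu ltrBlDl.
split.
  apply: (ah_cvgy mp podd c2_gt0 dG G0 ubG ahP) => e ed; near=> u.
  have u1 : u < c3 - Num.max e 0.
    by near: u; apply: nbhs_right_lt; rewrite ltrD2l ltrN2 gt_max ed.
  have u2 : c3 - d1 m c2 < u by near: u; exact: nbhs_right_gt.
  have um : Num.max e 0 < c3 - u by rewrite ltrBrDl -ltrBrDr.
  have [eu u0] : e < c3 - u /\ 0 < c3 - u by apply/andP; rewrite -gt_max.
  by rewrite distrC gtr0_norm// eu ltrBlDl -ltrBlDr.
exists (BG p c3 G) => fh D; split; first exact: (BG_is_BG_map mp podd c2_gt0 dG G0 ubG ahP).
split; first exact: (BG_C1 mp podd c2_gt0 dG G0 ubG ahP).
exact: (BG_minimal mp podd c2_gt0 dG G0 ubG ahP).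
Unshelve. all: by end_near. Qed.
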